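(* Let $g:U\times X\to X$ be a compactly driven system that has a causal mapping. Then the solution-map $\Psi:\overline{U}\to\overline{X}$ is continuous and is given by $$\Psi(\bar u)=\big(\ldots,h(\overleftarrow{u}^{-1}),h(\overleftarrow{u}),h(\overleftarrow{u}^{1}),\ldots\big),\qquad \bar u\in\overline{U},$$ where $h=\mathit{i}^{-1}\circ\mathcal{E}$, $h(\overleftarrow{u}^{r})$ is the $r$-th component of $\Psi(\bar u)$ for $r\in\mathbb{Z}$, and $h(\overleftarrow{u})$ (with $\overleftarrow{u}=\overleftarrow{u}^{0}$) is the $0$-th component. If, further, a causal embedding $H$ exists, then the solution-map $\Psi:\overline{U}\to\overline{X}$ is an embedding, i.e. a homeomorphism onto its image.
   Context: A driven system consists of a metric space $(U,d_U)$, a compact metric space $(X,d)$ and a continuous map $g:U\times X\to X$. It is a compactly driven system if in addition $U$ is compact. Write $g_u(x):=g(u,x)$. For a space $Y$ let $\overline{Y}:=\prod_{i\in\mathbb{Z}}Y$ and $\overleftarrow{Y}:=\prod_{i=-\infty}^{-1}Y$, with product topologies. For $\bar u=\{u_n\}\in\overline{U}$ and $n\in\mathbb{Z}$ put $\overleftarrow{u}^{n}:=(\ldots,u_{n-2},u_{n-1})$, regarded as an element of $\overleftarrow{U}$ whose last entry is $u_{n-1}$. A solution for input $\bar u\in\overline{U}$ is a sequence $\{x_n\}_{n\in\mathbb{Z}}$ in $X$ with $x_{n+1}=g(u_n,x_n)$ for all $n\in\mathbb{Z}$. The system $g$ has the unique solution property (USP) if for each $\bar u\in\overline{U}$ there is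 exactly one solution; then the solution-map $\Psi:\overline{U}\to\overline{X}$ sends $\bar u$ to this unique solution. (For a compactly driven system, existence of a causal mapping is equivalent to the USP, so $\Psi$ is well defined in the claim.) The reachable set $X_U\subset X$ is the set of all $x\in X$ such that $x=x_k$ for some $k\in\mathbb{Z}$ and some solution $\{x_n\}$ for some $\bar u\in\overline{U}$. $\overleftarrow{X}_U$ denotes the space of left-infinite solutions, i.e. the set of all $(\ldots,x_{-2},x_{-1})\in\overleftarrow{X}$ that arise as left-infinite segments $(\ldots,x_{k-2},x_{k-1})$, $k\in\mathbb{Z}$, of solutions $\{x_n\}$ for inputs $\bar u\in\overline{U}$, with the topology inherited from the product topology. For $v\in U$, $\sigma_v:\overleftarrow{U}\to\overleftarrow{U}$ is $\sigma_v(\ldots,u_{-2},u_{-1})=(\ldots,u_{-2},u_{-1},v)$, and $\tilde g_v(\ldots,x_{-2},x_{-1})=(\ldots,x_{-2},x_{-1},g(v,x_{-1}))$, which maps $\overleftarrow{X}_U$ to itself. A causal mapping is a continuous surjective map $H:\overleftarrow{U}\to\overleftarrow{X}_U$ with $\tilde g_v\circ H=H\circ\sigma_v$ for all $v\in U$. A causal embedding is a causal mapping that is a homeomorphism from $\overleftarrow{U}$ onto $\overleftarrow{X}_U$. The encoding map is $\mathcal{E}(\overleftarrow{u}):=\bigcap_{n\ge1}g_{u_{-1}}\circ\cdots\circ g_{u_{-n}}(X)$ for $\overleftarrow{u}=(\ldots,u_{-2},u_{-1})\in\overleftarrow{U}$; it is a nonempty closed subset of $X$. The system $g$ has the USP if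 and only if $\mathcal{E}(\overleftarrow{u})$ is a singleton for every $\overleftarrow{u}$. With $\mathit{i}:x\mapsto\{x\}$, $\mathit{i}^{-1}\circ\mathcal{E}$ then sends $\overleftarrow{u}$ to the unique element of $\mathcal{E}(\overleftarrow{u})$. *)

(* Defs.v *)
From HB Require Import structures.
From mathcomp Require Import all_boot all_order all_algebra.
From mathcomp Require Import all_classical all_reals all_analysis.

Set Implicit Arguments.
Unset Strict Implicit.
Unset Printing Implicit Defensive.

Import Order.TTheory GRing.Theory Num.Theory.
Local Open Scope classical_set_scope.
Local Open Scope ring_scope.

Notation biseq Y := {ptws int -> Y}.

(* A left-infinite sequence (..., w_{-2}, w_{-1}) is indexed by nat from right
   to left: w k stands for w_{-(k+1)}, so that w 0%N is the last entry. *)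
Notation leftseq Y := {ptws nat -> Y}.

(* past n y = (..., y_{n-2}, y_{n-1}) *)
Definition past (Y : Type) (n : int) (y : biseq Y) : leftseq Y :=
  fun k => y (n - k.+1%:Z).

(* append v (..., w_{-2}, w_{-1}) = (..., w_{-2}, w_{-1}, v); for sequences of
   inputs this is the shift sigma_v *)
Definition append (Y : Type) (v : Y) (w : leftseq Y) : leftseq Y :=
  fun k => if k is k'.+1 then w k' else v.

Section Topology.
Variables S T : topologicalType.

Definition homeomorphism (f : S -> T) : Prop :=
  continuous f /\
  exists f' : T -> S, [/\ cancel f f', cancel f' f & continuous f'].

Definition corestriction (f : S -> T) (s : S) : range f :=
  exist _ (f s) (mem_set (imageT f s)).

End Topology.

(* The image carries the subspace topology, that of set_type (range f). *)
Definition embedding (S T : topologicalType) (f : S -> T) : Prop :=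
  homeomorphism (corestriction f).

Section DrivenSystem.
Variables (R : realType) (U X : metricType R).

Definition driven_system (g : U * X -> X) : Prop :=
  compact [set: X] /\ continuous g.

Definition compactly_driven_system (g : U * X -> X) : Prop :=
  driven_system g /\ compact [set: U].

Variable g : U * X -> X.

Definition solution (u : biseq U) (x : biseq X) : Prop :=
  forall n : int, x (n + 1) = g (u n, x n).

Definition usp : Prop := forall u : biseq U, exists! x : biseq X, solution u x.

Definition solution_map (g_usp : usp) (u : biseq U) : biseq X :=
  sval (cid (g_usp u)).

Definition left_solutions : set (leftseq X) :=
  [set w | exists (u : biseq U) (x : biseq X) (k : int),
             solution u x /\ w = past k x].

Definition gtilde (v : U) (w : leftseq X) : leftseq X :=
  append (g (v, w 0%N)) w.

(* The codomain of H is the subspace left_solutions, seen as a type. *)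
Definition causal_mapping (H : leftseq U -> left_solutions) : Prop :=
  [/\ continuous H,
      range H = [set: left_solutions] &
      forall (v : U) (w : leftseq U),
        gtilde v (set_val (H w)) = set_val (H (append v w))].

Definition causal_embedding (H : leftseq U -> left_solutions) : Prop :=
  causal_mapping H /\ homeomorphism H.

(* iter_past n w = g_{w_{-1}} \o ... \o g_{w_{-n}} *)
Fixpoint iter_past (n : nat) (w : leftseq U) (x : X) : X :=
  if n is n'.+1 then iter_past n' w (g (w n', x)) else x.

Definition encoding (w : leftseq U) : set X :=
  \bigcap_(n in [set n | (1 <= n)%N]) range (iter_past n w).

Definition encoding_singleton : Prop :=
  forall w : leftseq U, exists x : X, encoding w = [set x].

(* h = i^-1 \o E, where i x = [set x] *)
Definition encoding_point (E1 : encoding_singleton) (w : leftseq U) : X :=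
  sval (cid (E1 w)).

End DrivenSystem.

(* Main.v *)
Require Import Defs.
From HB Require Import structures.
From mathcomp Require Import all_boot all_order all_algebra.
From mathcomp Require Import all_classical all_reals all_analysis.
From mathcomp Require Import zify.

(** Everything follows from one identity: if [H] is a causal mapping and [x]
    solves the system for the input [u], then [H] sends [(..., u_{n-1})] to
    [(..., x_{n-1}, x_n)] ([causal_past]).  To see why, write the left-infinite
    solution ending in [x_{n-m}] as [H w], which surjectivity allows, and append
    [u_{n-m}, ..., u_{n-1}] to [w].  By equivariance the result is still sent to
    the solution ending in [x_n], and it agrees with the past of [u] on the last
    [m] entries.  As [m] grows these inputs converge to the past of [u] while
    their image is constant, so continuity of [H] gives the identity.

    Consequently [x_n] is the last entry of [H (past n u)], which proves
    uniqueness of solutions; that this formula does define a solution is again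
    equivariance ([causal_usp]).  It also exhibits each coordinate of the
    solution map as a continuous function of the input.

    The set [encoding w] consists of the possible present states given the
    past input [w].  By compactness of [X] each such state is the end of an
    infinite backward orbit along [w] ([encoding_left_orbit]), hence it is the
    value at time [0] of a genuine solution, and [causal_past] identifies it with
    the last entry of [H w] ([causal_encoding]).  This is the formula for the
    solution map in terms of [encoding_point].

    When [H] is a homeomorphism, [u_n] can be read off continuously from the
    solution: it is the last entry of the inverse image under [H] of
    [(..., x_n, x_{n+1})].  So the solution map has a continuous inverse on its
    image ([solution_map_embedding]). *)

Set Implicit Arguments.
Unset Strict Implicit.
Unset Printing Implicit Defensive.

Import Order.TTheory GRing.Theory Num.Theory.
Local Open Scope classical_set_scope.
Local Open Scope ring_scope.

(** * Topology of pointwise convergence *)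

Lemma ptws_cvg (S : Type) (F : set_system S) (I : eqType)
    (T : topologicalType) (f : S -> {ptws I -> T}) (l : {ptws I -> T}) :
  Filter F -> (forall i, f s i @[s --> F] --> l i) -> f @ F --> l.
Proof.
move=> FF fl; apply/cvg_sup => i A [_ [[B oB <-] Bl] sBA].
apply: (filterS sBA); apply: (fl i).
exact: open_nbhs_nbhs.
Qed.

Lemma ptws_continuous (S : topologicalType) (I : eqType)
    (T : topologicalType) (f : S -> {ptws I -> T}) :
  (forall i, continuous (fun s => f s i)) -> continuous f.
Proof. by move=> fc s; apply: ptws_cvg => i; exact: fc. Qed.

Lemma eval_continuous (I : eqType) (T : topologicalType) (i : I) :
  continuous (fun f : {ptws I -> T} => f i).
Proof. exact: (@proj_continuous I (fun=> T) i). Qed.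

(** Closed relations pass to cluster points; stated for an equation between
    continuous functions, so that the orbit equations survive the limit
    extracted by compactness. *)
Lemma cluster_eq (S T : topologicalType) (F : set_system S) (a b : S -> T)
    (p : S) :
  hausdorff_space T -> continuous a -> continuous b ->
  F [set s | a s = b s] -> cluster F p -> a p = b p.
Proof.
move=> hT ac bc Fab Fp; apply: hT => A B nA nB.
have nAB : nbhs p (a @^-1` A `&` b @^-1` B).
  by apply: filterI; [exact: ac|exact: bc].
have [s [/= sab [sA sB]]] := Fp _ _ Fab nAB.
by exists (a s); split=> //; rewrite sab.
Qed.

(** * Pasts of two-sided sequences *)

Lemma past_succ (Y : Type) (n : int) (y : biseq Y) :
  past (n + 1) y = append (y n) (past n y).
Proof.
by apply/funext => -[|k]; rewrite /past /=; congr y; lia.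
Qed.

Lemma past_continuous (Y : topologicalType) (n : int) :
  continuous (past n : biseq Y -> leftseq Y).
Proof. by apply: ptws_continuous => k; exact: eval_continuous. Qed.

(** The entries from time [0] on are immaterial: repeating the last entry of
    [w] provides one without assuming that [Y] is inhabited. *)
Definition prolong (Y : Type) (w : leftseq Y) : biseq Y :=
  fun n => if n is Negz k then w k else w 0%N.

Lemma past_prolong (Y : Type) (w : leftseq Y) : past 0 (prolong w) = w.
Proof. by apply/funext => k; rewrite /past sub0r -NegzE. Qed.

(** * Backward orbits and the encoding map *)

Section DrivenSystem.
Variables (R : realType) (U X : metricType R) (g : U * X -> X).

(** The state at time [n] is produced by the inputs before time [n], so the
    past of the solution that corresponds to [past n u] is [past (n + 1) x]. *)
Lemma gtilde_past (u : biseq U) (x : biseq X) (n : int) :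
  solution g u x -> gtilde g (u n) (past (n + 1) x) = past (n + 1 + 1) x.
Proof.
move=> gux; rewrite (past_succ (n + 1)) gux /gtilde.
by congr (append (g (_, _)) _); rewrite /past; congr x; lia.
Qed.

(** [iter_past] is defined by peeling off the oldest input; here the most
    recent one is peeled off. *)
Lemma iter_past_head (n : nat) (w : leftseq U) (x : X) :
  iter_past g n.+1 w x = g (w 0%N, iter_past g n (fun k => w k.+1) x).
Proof. by elim: n x => //= n IHn x; rewrite -IHn. Qed.

Lemma solution_iter_past (u : biseq U) (x : biseq X) (r : int) (n : nat) :
  solution g u x -> iter_past g n (past r u) (x (r - n%:Z)) = x r.
Proof.
move=> gux; elim: n => [|n IHn] /=; first by rewrite subr0.
rewrite -[in RHS]IHn /past -gux; congr (iter_past g n _ (x _)); lia.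
Qed.

(** The state [s k] is the one at time [-k], reached by applying the input
    [w k], at time [-(k+1)], to [s k.+1]. *)
Definition left_orbit (w : leftseq U) (s : leftseq X) : Prop :=
  forall k, s k = g (w k, s k.+1).

Lemma left_orbit_extend (w : leftseq U) (s : leftseq X) :
  left_orbit w s ->
  exists (u : biseq U) (x : biseq X),
    [/\ solution g u x, past 0 u = w & x 0 = s 0%N].
Proof.
move=> ws.
pose x : biseq X := fun n => match n with
  | Posz k => iter k (fun y => g (w 0%N, y)) (s 0%N)
  | Negz k => s k.+1 end.
exists (prolong w), x; split; [|exact: past_prolong|by []].
move=> [n|[|k]]; first by rewrite -PoszD addn1.
  exact: ws.
by rewrite (_ : Negz k.+1 + 1 = Negz k); [exact: ws|lia].
Qed.

(** A point of [encoding w] has for every [n] a backward orbit of length [n],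
    but the orbits for different [n] need not extend one another.  Compactness of
    the space of left-infinite sequences yields a cluster point of these finite
    orbits, and this is an infinite one. *)
Lemma encoding_left_orbit (w : leftseq U) (y : X) :
  compact [set: X] -> continuous g -> encoding g w y ->
  exists2 s : leftseq X, left_orbit w s & s 0%N = y.
Proof.
move=> Xc gc wy.
have {wy} /choice[z zy] : forall n, exists z, iter_past g n w z = y.
  by case=> [|n]; [exists y|have [z _ <-] := wy n.+1 isT; exists z].
(* [s n] is the orbit started from [z n] at time [-n]; for [k > n] its entries
   are just [z n]. *)
pose s (n : nat) : leftseq X :=
  fun k => iter_past g (n - k) (fun j => w (k + j)%N) (z n).
have sS n k : (k < n)%N -> s n k = g (w k, s n k.+1).
  move=> kn; rewrite /s (_ : (n - k)%N = (n - k.+1).+1); last by lia.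
  rewrite iter_past_head addn0; congr (g (_, iter_past g _ _ _)).
  by apply/funext => j; rewrite addnS addSn.
have s0 n : s n 0%N = y by rewrite /s subn0.
have Xsc : compact [set f : leftseq X | forall k, [set: X] (f k)].
  exact: (@tychonoff nat (fun=> X) (fun=> setT)).
have [//|p [_ sp]] := Xsc (s @ \oo) _; first exact: filterE.
exists p.
- move=> k; apply: (@cluster_eq _ _ (s @ \oo) (fun f => f k)
    (fun f => g (w k, f k.+1)) p _ _ _ _ sp).
  + exact: metric_hausdorff.
  + exact: eval_continuous.
  + move=> f; apply: (@continuous_comp _ _ _
      (fun f : leftseq X => (w k, f k.+1)) g); last exact: gc.
    apply: (@cvg_pair _ _ _ (nbhs f) (nbhs (w k)) (nbhs (f k.+1))).
      exact: cvg_cst.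
    exact: eval_continuous.
  + by exists k.+1 => //= n /= kn; exact: sS.
- apply: (@cluster_eq _ _ (s @ \oo) (fun f => f 0%N) (fun=> y) p _ _ _ _ sp).
  + exact: metric_hausdorff.
  + exact: eval_continuous.
  + exact: cst_continuous.
  + by exists 0%N => // n _; exact: s0.
Qed.

(** * Consequences of a causal mapping *)

Section CausalMapping.
Variable H : leftseq U -> left_solutions g.
Hypothesis H_causal : causal_mapping H.

Let val_continuous (k : nat) : continuous (fun w => set_val (H w) k).
Proof.
have [Hc _ _] := H_causal => w.
apply: (@continuous_comp _ _ _ (set_val \o H) (fun f : leftseq X => f k)).
  apply: continuous_comp; first exact: Hc.
  exact: (@initial_continuous _ _ (set_val : left_solutions g -> leftseq X)).
exact: eval_continuous.
Qed.

(** Surjectivity of [H] gives a preimage whose entries are unrelated to the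
    input [u]; going [m] steps back before choosing it and then appending the
    last [m] inputs corrects these entries. *)
Lemma causal_past_approx (u : biseq U) (x : biseq X) (m : nat) (n : int) :
  solution g u x ->
  exists2 w : leftseq U, set_val (H w) = past (n + 1) x &
    forall k, (k < m)%N -> w k = past n u k.
Proof.
have [_ Hsurj Hg] := H_causal; move=> gux.
elim: m n => [|m IHm] n.
  have xL : left_solutions g (past (n + 1) x) by exists u, x, (n + 1).
  pose xl : left_solutions g :=
    exist (fun w => w \in left_solutions g) _ (mem_set xL).
  have [w _ Hw] : range H xl by rewrite Hsurj.
  by exists w => //; rewrite Hw.
have [w Hw wu] := IHm (n - 1).
have nE : n = n - 1 + 1 by rewrite subrK.
exists (append (u (n - 1)) w); first by rewrite -Hg Hw gtilde_past// -nE.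
by move=> k km; rewrite nE past_succ -nE; case: k km => // k km; exact: wu.
Qed.

(** The preimages of [past (n + 1) x] given by [causal_past_approx] converge to
    [past n u], and [H] is constant on them. *)
Lemma causal_past (u : biseq U) (x : biseq X) (n : int) :
  solution g u x -> set_val (H (past n u)) = past (n + 1) x.
Proof.
move=> gux.
have /choice[w Hw] m : exists w : leftseq U, set_val (H w) = past (n + 1) x /\
    forall k, (k < m)%N -> w k = past n u k.
  by have [w] := causal_past_approx m n gux; exists w.
have wu : w @ \oo --> past n u.
  apply: ptws_cvg => k; apply: cvg_near_cst.
  by exists k.+1 => // m /= km; rewrite (Hw m).2.
apply/funext => k.
have wk : (fun m => set_val (H (w m)) k) @ \oo --> set_val (H (past n u)) k.
  exact: (cvg_comp _ _ wu (@val_continuous k (past n u))).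
rewrite (_ : (fun m => _) = fun=> past (n + 1) x k) in wk.
  exact: (cvg_unique (@metric_hausdorff _ X) wk (cvg_cst _)).
by apply/funext => m; rewrite (Hw m).1.
Qed.

Lemma causal_solution_value (u : biseq U) (x : biseq X) (n : int) :
  solution g u x -> x n = set_val (H (past n u)) 0%N.
Proof. by move=> /causal_past->; rewrite /past addrK. Qed.

Lemma causal_solution (u : biseq U) :
  solution g u (fun n => set_val (H (past n u)) 0%N).
Proof.
by have [_ _ Hg] := H_causal; move=> n; rewrite past_succ -Hg.
Qed.

Lemma causal_usp : usp g.
Proof.
move=> u; exists (fun n => set_val (H (past n u)) 0%N).
split; first exact: causal_solution.
by move=> x gux; apply/funext => n; exact/esym/causal_solution_value.
Qed.

(** One inclusion turns a point of the encoding into the value of a solution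
    whose past input is [w]; the other follows the solution given by [H] from
    time [-n] to time [0]. *)
Lemma causal_encoding (w : leftseq U) :
  compact [set: X] -> continuous g ->
  encoding g w = [set set_val (H w) 0%N].
Proof.
move=> Xc gc; apply/seteqP; split=> [y|_ ->] /=.
  move=> /(encoding_left_orbit Xc gc)[s /left_orbit_extend[u [x []]]].
  by move=> gux <- <- <-; exact: causal_solution_value.
move=> n _; have := solution_iter_past 0 n (causal_solution (prolong w)).
by rewrite past_prolong => <-; eexists.
Qed.

Lemma solution_map_causal (g_usp : usp g) (u : biseq U) (n : int) :
  solution_map g_usp u n = set_val (H (past n u)) 0%N.
Proof.
rewrite /solution_map; case: cid => x [/= gux _].
exact: causal_solution_value.
Qed.

Lemma solution_map_continuous (g_usp : usp g) :
  continuous (solution_map g_usp).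
Proof.
apply: ptws_continuous => n u.
rewrite (_ : (fun v => _) = (fun w => set_val (H w) 0%N) \o past n).
  by apply: continuous_comp; [exact: past_continuous|exact: val_continuous].
by apply/funext => v /=; exact: solution_map_causal.
Qed.

End CausalMapping.

(** * The solution map as an embedding *)

Lemma solution_mapP (g_usp : usp g) (u : biseq U) :
  solution g u (solution_map g_usp u).
Proof. by rewrite /solution_map; case: cid => x []. Qed.

(** The input at time [n] is the last entry of [past (n + 1) u], whose image
    under [H] is [past (n + 2) x]; applying the inverse of [H] recovers it
    continuously from [x]. *)
Lemma solution_map_embedding (H : leftseq U -> left_solutions g)
    (g_usp : usp g) :
  causal_embedding H -> embedding (solution_map g_usp).
Proof.
move=> [Hc [_ [H' [HK _ H'c]]]].
set Psi := solution_map g_usp.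
have pastL n (x : range Psi) : past n (set_val x) \in left_solutions g.
  rewrite inE set_valE; have [u _ <-] := set_valP x.
  by exists u, (Psi u), n; split=> //; exact: solution_mapP.
pose lsol n (x : range Psi) : left_solutions g :=
    exist (fun w => w \in left_solutions g) _ (pastL n x).
pose Psi' : range Psi -> biseq U := fun x n => H' (lsol (n + 1 + 1) x) 0%N.
have PsiK : cancel (corestriction Psi) Psi'.
  move=> u; apply/funext => n; rewrite /Psi'.
  rewrite (_ : lsol _ _ = H (past (n + 1) u)).
    by rewrite HK /past addrK.
  apply: val_inj => /=.
  exact/esym/(causal_past Hc (n + 1))/solution_mapP.
split.
  apply: continuous_comp_initial; exact: (solution_map_continuous Hc).
exists Psi'; split=> //.
- move=> x; have [u _ ux] := set_valP x.
  suff -> : x = corestriction Psi u by rewrite PsiK.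
  exact/val_inj.
- apply: ptws_continuous => n x.
  apply: (@continuous_comp _ _ _ (H' \o lsol (n + 1 + 1))
    (fun w : leftseq U => w 0%N)); last exact: eval_continuous.
  apply: continuous_comp; last exact: H'c.
  apply: continuous_comp_initial => {}x.
  apply: (@continuous_comp _ _ _ (set_val : range Psi -> biseq X)
    (past (n + 1 + 1) : biseq X -> leftseq X)).
    exact: initial_continuous.
  exact: past_continuous.
Qed.

End DrivenSystem.

(** * Continuity, formula and embedding *)

Theorem theorem3 (R : realType) (U X : metricType R) (g : U * X -> X)
    (g_compact : compactly_driven_system g)
    (g_causal : exists H : leftseq U -> left_solutions g, causal_mapping H) :
  exists (g_usp : usp g) (g_sing : encoding_singleton g),
    [/\ continuous (solution_map g_usp),
        (forall (u : biseq U) (r : int),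
           solution_map g_usp u r = encoding_point g_sing (past r u)) &
        (exists H : leftseq U -> left_solutions g, causal_embedding H) ->
        embedding (solution_map g_usp)].
Proof.
have [[Xc gc] _] := g_compact; have [H Hc] := g_causal.
have g_sing : encoding_singleton g.
  by move=> w; exists (set_val (H w) 0%N); exact: causal_encoding.
exists (causal_usp Hc), g_sing; split.
- exact: (solution_map_continuous Hc).
- move=> u r; rewrite (solution_map_causal Hc) /encoding_point.
  by case: cid => y /=; rewrite (causal_encoding Hc) // => /seteqP[/(_ _ erefl)].
- by move=> [H' H'c]; exact: solution_map_embedding H'c.
Qed.
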